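(* Let $A$ be an $n\times n$ real positive semidefinite matrix such that $A_{ii}\le 1$ for all $i$. Then, for any $r\in\mathbb{N}$, there exists a partition $[n]=I_1\cup\cdots\cup I_k$ with $k\le 2^r$, and an $n\times n$ matrix $B$ that is constant on each block $I_i\times I_j$, such that $$\frac1n\|A-B\|_F\le\frac{\pi}{\sqrt r}.$$ Moreover, $B$ can be computed by averaging the entries of $A$ in each block, i.e. one can take $B_{pq}=\frac{1}{|I_i||I_j|}\sum_{s\in I_i,\,t\in I_j}A_{st}$ for all $p\in I_i$, $q\in I_j$.
   Context: $\mathbb{N}=\{1,2,3,\dots\}$ and $[n]=\{1,\dots,n\}$. Positive semidefinite matrices are symmetric. $\|M\|_F=\big(\sum_{i,j}M_{ij}^2\big)^{1/2}$ is the Frobenius norm. The parts of a partition are pairwise disjoint and nonempty. *)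

(* Defs.v *)
From mathcomp Require Import all_boot all_order all_algebra.
From mathcomp Require Import reals trigo.

Set Implicit Arguments.
Unset Strict Implicit.
Unset Printing Implicit Defensive.

Import Order.TTheory GRing.Theory Num.Theory.

Local Open Scope ring_scope.

Definition psdmx (R : realType) (n : nat) (A : 'M[R]_n) : Prop :=
  A^T = A /\ forall x : 'cV[R]_n, 0 <= (x^T *m A *m x) 0 0.

Definition frobenius (R : realType) (m n : nat) (M : 'M[R]_(m, n)) : R :=
  Num.sqrt (\sum_i \sum_j M i j ^+ 2).

Definition block_constant (R : realType) (n : nat) (P : {set {set 'I_n}})
    (B : 'M[R]_n) : Prop :=
  forall I J, I \in P -> J \in P ->
    exists c : R, forall p q, p \in I -> q \in J -> B p q = c.

Definition block_average (R : realType) (n : nat) (P : {set {set 'I_n}})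
    (A B : 'M[R]_n) : Prop :=
  forall I J, I \in P -> J \in P -> forall p q, p \in I -> q \in J ->
    B p q = (#|I|%:R * #|J|%:R)^-1 * \sum_(s in I) \sum_(t in J) A s t.

(* Main.v *)
Require Import Defs.
From mathcomp Require Import all_boot all_order all_algebra.
From mathcomp Require Import reals trigo.
From mathcomp Require Import boolp topology normedtype sequences derive realfun.
From mathcomp Require Import exp ring lra.

(** Raising the diagonal entries of A to 1 keeps A semidefinite and makes it the
    Gram matrix of unit vectors v_i. For a standard Gaussian vector g,
    E[sin<g,v_i> sin<g,v_j>] = sinh(A_ij)/e, and rounding the numbers sin<g,v_i>
    independently to signs does not change the expectation of an off-diagonal
    product. Hence, off the diagonal, the matrix K_ij = sinh(A_ij)/e is an average
    of matrices s s^T with s a sign vector. By Maurey's argument, r sign vectors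
    s_1, ..., s_r suffice for an approximation of K by the mean of the s_k s_k^T
    with squared off-diagonal error at most n^2/r. This mean is constant on the
    blocks of the partition of [n] into at most 2^r classes of equal sign
    patterns. The inverse of a |-> sinh(a)/e is e-Lipschitz, so applying it gives
    a block constant matrix at squared distance at most e^2 n^2/r + n from A, and
    block averages do at least as well. If 2^r < n then r < n, and
    e^2 + 1 <= 9 <= pi^2; otherwise the partition into singletons will do.
    Instead of Gaussian vectors the proof uses sums of many small independent
    signs, and averages are only used to find a point not above them. *)

Set Implicit Arguments.
Unset Strict Implicit.
Unset Printing Implicit Defensive.

Import Order.TTheory GRing.Theory Num.Theory.
Import numFieldNormedType.Exports.

Local Open Scope ring_scope.

(** * Taylor bounds for sine, cosine and the exponential *)

Lemma derive_ge0_le (R : realType) (f f' : R -> R) (a b : R) :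
  (forall x, is_derive x (1 : R) f (f' x)) -> (forall x, a <= x -> 0 <= f' x) ->
  a <= b -> f a <= f b.
Proof.
move=> df f'_ge0 ab; apply: (@ger0_derive1_ndecry _ f a) => // [x|].
- by rewrite in_itv/= andbT derive1E => /ltW/f'_ge0; rewrite derive_val.
- apply: derivable_within_continuous => x _; exact: ex_derive.
Qed.

Lemma sin_le_id (R : realType) (x : R) : 0 <= x -> sin x <= x.
Proof.
move=> x0; rewrite -subr_ge0.
have -> : 0 = 0 - sin 0 :> R by rewrite sin0 subr0.
apply: (@derive_ge0_le R (fun y => y - sin y) (fun y => 1 - cos y)) => // y _.
by rewrite subr_ge0 cos_le1.
Qed.

Lemma cos_ge_quadratic (R : realType) (x : R) : 1 - x ^+ 2 / 2 <= cos x.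
Proof.
wlog x0 : x / 0 <= x => [H|].
  by have [/H//|/ltW x0] := leP 0 x; rewrite -sqrrN -cosN H// oppr_ge0.
pose f (y : R) := cos y + 2^-1 * y ^+ 2.
suff : f 0 <= f x by rewrite /f cos0; lra.
apply: (@derive_ge0_le R f (fun y => y - sin y)) => // [y|y y0].
  by rewrite /f; apply: is_derive_eq; rewrite /GRing.scale/=; field.
by rewrite subr_ge0 sin_le_id.
Qed.

Lemma sin_ge_cubic (R : realType) (x : R) : 0 <= x -> x - x ^+ 3 / 6 <= sin x.
Proof.
move=> x0; pose f (y : R) := sin y - y + 6^-1 * y ^+ 3.
suff : f 0 <= f x by rewrite /f sin0; lra.
apply: (@derive_ge0_le R f (fun y => cos y - (1 - y ^+ 2 / 2))) => // [y|y y0].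
  by rewrite /f; apply: is_derive_eq; rewrite /GRing.scale/=; field.
by rewrite subr_ge0 cos_ge_quadratic.
Qed.

Lemma cos_le_quartic (R : realType) (x : R) :
  cos x <= 1 - x ^+ 2 / 2 + x ^+ 4 / 24.
Proof.
wlog x0 : x / 0 <= x => [H|].
  have [/H//|/ltW x0] := leP 0 x.
  by rewrite -cosN -(sqrrN x) (_ : x ^+ 4 = (- x) ^+ 4) ?H ?oppr_ge0//; ring.
pose f (y : R) := - cos y - 2^-1 * y ^+ 2 + 24^-1 * y ^+ 4.
suff : f 0 <= f x by rewrite /f cos0; lra.
apply: (@derive_ge0_le R f (fun y => sin y - (y - y ^+ 3 / 6))) => // [y|y y0].
  by rewrite /f; apply: is_derive_eq; rewrite /GRing.scale/=; field.
by rewrite subr_ge0 sin_ge_cubic.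
Qed.

(** Both functions lie between [1 - x ^+ 2 / 2] and [1 - x ^+ 2 / 2 + x ^+ 4 / 4]. *)
Lemma cos_expR_dist (R : realType) (x : R) :
  `|cos x - expR (- (x ^+ 2 / 2))| <= x ^+ 4 / 4.
Proof.
have cge := cos_ge_quadratic x; have cle := cos_le_quartic x.
have ege := expR_ge1Dx (- (x ^+ 2 / 2)).
have y0 := sqr_ge0 x.
(* With [y = x ^+ 2 / 2]: [exp (- y) <= 1 / (1 + y) <= 1 - y + y ^+ 2]. *)
have ele : expR (- (x ^+ 2 / 2)) <= 1 - x ^+ 2 / 2 + x ^+ 4 / 4.
  have ele' := expR_ge1Dx (x ^+ 2 / 2).
  rewrite expRN invf_ple ?posrE ?expR_gt0//; last by nra.
  apply: le_trans ele'.
  rewrite -[leLHS]div1r ler_pdivrMr; last by nra.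
  by nra.
have x4 : 0 <= x ^+ 4 by rewrite exprn_even_ge0.
by rewrite ler_norml; apply/andP; split; lra.
Qed.

Lemma sinh_sub_ge (R : realType) (a b : R) : a <= b ->
  2 * (b - a) <= (expR b - expR (- b)) - (expR a - expR (- a)).
Proof.
move=> ab; pose f (y : R) := expR y - expR (- y) - 2 * y.
suff : f a <= f b by rewrite /f; lra.
apply: (@derive_ge0_le R f (fun y => expR y + expR (- y) - 2)) => // [y|y y0].
  by rewrite /f; apply: is_derive_eq; rewrite /GRing.scale/=; ring.
have p := expR_gt0 y.
rewrite expRN subr_ge0 -(ler_pM2r p) [leRHS]mulrDl mulVf ?gt_eqF//.
by have := sqr_ge0 (expR y - 1); rewrite sqrrB1; lra.
Qed.

(** * Numerical bounds on pi and e *)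

(** [1 / 2 = sin (pi / 6) <= pi / 6] *)
Lemma pi_ge3 (R : realType) : 3 <= pi :> R.
Proof.
have pi0 := pi_gt0 R.
have c0 : 0 < cos (pi / 6) :> R.
  by apply: cos_gt0_pihalf; apply/andP; split; lra.
have s0 : 0 <= sin (pi / 6) :> R.
  by apply: sin_ge0_pi; apply/andP; split; lra.
have : cos (pi / 2) = 0 :> R by rewrite cos_pihalf.
have -> : pi / 2 = pi / 6 *+ 2 + pi / 6 :> R by rewrite mulr2n; field.
rewrite cosD cos_mulr2n sin_mulr2n.
have := cos2Dsin2 (pi / 6 : R).
have := sin_le_id (ltW (divr_gt0 pi0 (ltr0n _ 6))).
move: c0 s0; set c := cos _; set s := sin _ => c0 s0 sle cs e.
have s2 : s ^+ 2 = 1 - c ^+ 2 by lra.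
have e2 : c * (4 * c ^+ 2 - 3) = 0 by rewrite -[RHS]e; ring: s2.
have c2 : 4 * c ^+ 2 - 3 = 0.
  by move/eqP: e2; rewrite mulf_eq0 gt_eqF//= => /eqP.
have s_ge : s >= 1 / 2 by nra.
lra.
Qed.

(** Repeated squaring of [exp (- 1 / 16) >= 15 / 16], rounding down to three decimals from the
    fourth power on; finally [0.354 ^+ 2 > 1 / 8]. *)
Lemma expR1_sqr_le8 (R : realType) : expR 1 ^+ 2 <= 8 :> R.
Proof.
have e1 := expR_ge1Dx (- (16^-1) : R).
have -> : expR 1 = (expR (- 16^-1) ^+ 16)^-1 :> R.
  by rewrite -expRM_natl -expRN; congr expR; field.
move: e1; set x := expR _ => e1.
have sqr_mono (a b : R) : 0 <= a -> a <= b -> a ^+ 2 <= b ^+ 2.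
  by move=> a0 ab; rewrite lerXn2r ?nnegrE// (le_trans a0).
have x4 : 772 / 1000 <= x ^+ 2 ^+ 2.
  apply: le_trans (sqr_mono (225 / 256) _ _ _); [lra|lra|].
  by apply: le_trans (sqr_mono (15 / 16) _ _ _); lra.
have x16 : 354 / 1000 <= x ^+ 16.
  rewrite (_ : x ^+ 16 = x ^+ 2 ^+ 2 ^+ 2 ^+ 2); last ring.
  apply: le_trans (sqr_mono (595 / 1000) _ _ _); [lra|lra|].
  by apply: le_trans (sqr_mono (772 / 1000) _ _ x4); lra.
rewrite exprVn invf_ple ?posrE ?exprn_gt0//; try lra.
by apply: le_trans (sqr_mono (354 / 1000) _ _ x16); lra.
Qed.

(** * The function [sinh a / e] and its inverse *)

(** [sinh a / e], in the form in which it arises from [exp (- |v -+ w| ^ 2 / 2)]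
    for unit vectors [v], [w] with inner product [a]. *)
Definition scaled_sinh (R : realType) (a : R) : R :=
  (expR (a - 1) - expR (- a - 1)) / 2.

Lemma scaled_sinh_sub_ge (R : realType) (a b : R) : a <= b ->
  b - a <= expR 1 * (scaled_sinh b - scaled_sinh a).
Proof.
move=> ab; have := sinh_sub_ge ab.
suff E x : expR 1 * scaled_sinh x = (expR x - expR (- x)) / 2 :> R.
  by rewrite [expR 1 * _]mulrBr !E; lra.
by rewrite /scaled_sinh mulrA mulrBr -!expRD ![1 + _]addrC !subrK.
Qed.

Lemma scaled_sinh_dist (R : realType) (a b : R) :
  `|b - a| <= expR 1 * `|scaled_sinh b - scaled_sinh a|.
Proof.
wlog ab : a b / a <= b => [H|].
  have [/H//|/ltW/H] := leP a b.
  by rewrite distrC [`|scaled_sinh a - _|]distrC.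
rewrite ger0_norm ?subr_ge0//; apply: le_trans (scaled_sinh_sub_ge ab) _.
by rewrite ler_wpM2l ?expR_ge0// ler_norm.
Qed.

Lemma scaled_sinh_surj (R : realType) (t : R) : exists a, scaled_sinh a = t.
Proof.
pose u := expR 1 * t; pose v := Num.sqrt (u ^+ 2 + 1).
have v2 : v ^+ 2 = u ^+ 2 + 1 by rewrite sqr_sqrtr// addr_ge0 ?sqr_ge0.
have v0 : 0 <= v by rewrite sqrtr_ge0.
have uv : 0 < u + v.
  rewrite -ltrBlDl sub0r; have [u0|u0] := ltP 0 u; first by lra.
  by rewrite -(ltr_pXn2r (n := 2)) ?nnegrE//; lra.
(* This is [arsinh (e t)]. *)
exists (ln (u + v)).
rewrite /scaled_sinh !expRD !expRN lnK ?posrE// -mulrBl.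
have e0 := expR_gt0 (1 : R).
have -> : (u + v)^-1 = v - u.
  by apply: (mulfI (lt0r_neq0 uv)); rewrite divff ?gt_eqF//; ring: v2.
by rewrite /u; field; rewrite gt_eqF.
Qed.

(** The inverse is cut off at 1, which brings it no farther from any [a <= 1]. Since
    [scaled_sinh 1 < 1], the cut-off acts at 1 and gives [h 1 = 1]; this controls the diagonal,
    where products of equal signs average to 1. *)
Lemma scaled_sinh_inverse (R : realType) : exists h : R -> R, h 1 = 1 /\
  forall a t, a <= 1 -> `|h t - a| <= expR 1 * `|t - scaled_sinh a|.
Proof.
have [h hK] := choice (@scaled_sinh_surj R).
exists (fun t => Num.min 1 (h t)); split=> [|a t a1].
  apply/min_idPl; rewrite leNgt; apply/negP => /ltW h1.
  have := scaled_sinh_sub_ge h1; rewrite hK.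
  have : scaled_sinh 1 < 1 :> R.
    by rewrite /scaled_sinh subrr expR0; have := expR_gt0 (- 1 - 1 : R); lra.
  by have := expR_gt0 (1 : R); nra.
rewrite -{2}(hK t); apply: le_trans (scaled_sinh_dist _ _).
rewrite minElt; case: ltP => // ht.
by rewrite !ger0_norm; lra.
Qed.

(** * Rounding to signs *)

(** With zero diagonal the form is affine in each coordinate, so coordinates can be moved one at a
    time to an endpoint of [[-1, 1]] without increasing it. *)
Lemma quadratic_rounding (R : realType) (n : nat) (M : 'M[R]_n)
    (M0 : forall i, M i i = 0) (x : 'I_n -> R) (x1 : forall i, `|x i| <= 1) :
  exists s : {ffun 'I_n -> bool},
    \sum_i \sum_j M i j * ((-1) ^+ s i * (-1) ^+ s j) <=
    \sum_i \sum_j M i j * (x i * x j).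
Proof.
pose Q (y : 'I_n -> R) := \sum_i \sum_j M i j * (y i * y j).
suff H k : exists y : 'I_n -> R, [/\ forall i, `|y i| <= 1,
    forall i : 'I_n, (i < k)%N -> y i = 1 \/ y i = -1 & Q y <= Q x].
  have [y [_ y1 yx]] := H n.
  exists [ffun i => y i == -1]; apply: le_trans yx.
  rewrite le_eqVlt; apply/orP; left; apply/eqP.
  have E i : (-1) ^+ ([ffun i => y i == -1] i) = y i.
    rewrite ffunE; have [->|->] := y1 i (ltn_ord i).
      by rewrite gt_eqF//; lra.
    by rewrite eqxx.
  by apply: eq_bigr => i _; apply: eq_bigr => j _; rewrite !E.
elim: k => [|k [y [y1 yk yx]]]; first by exists x.
have [kn|kn] := ltnP k n; last first.
  by exists y; split=> // i _; apply: yk; exact: leq_trans kn.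
pose i0 := Ordinal kn; pose up c i := if i == i0 then c else y i.
have Qy : Q y = (1 + y i0) / 2 * Q (up 1) + (1 - y i0) / 2 * Q (up (-1)).
  rewrite /Q !mulr_sumr -big_split; apply: eq_bigr => i _ /=.
  rewrite !mulr_sumr -big_split; apply: eq_bigr => j _ /=.
  by rewrite /up; case: eqP => [->|_]; case: eqP => [->|_]; rewrite ?M0; field.
have := y1 i0; rewrite ler_norml => /andP[yl yu].
have [c [c1 Qc]] : exists c, (c = 1 \/ c = -1) /\ Q (up c) <= Q y.
  have [le|lt] := leP (Q (up 1)) (Q y); first by exists 1; split; [left|].
  exists (-1); split; first by right.
  (* If [y i0 = -1], then [up 1] has weight 0 in [Qy]; otherwise its weight is positive, and
     [Q (up 1) > Q y] forces [Q (up (-1)) <= Q y]. *)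
  have [t1|t1] := leP 1 (- y i0).
    have yE : y i0 = -1 by lra.
    by rewrite Qy yE; lra.
  have : 0 < (1 + y i0) * (Q (up 1) - Q y) by rewrite mulr_gt0//; lra.
  by rewrite leNgt => p; apply/negP => q; nra.
exists (up c); split=> [i|i ik|]; last exact: le_trans yx.
  by rewrite /up; case: eqP => // _; case: c1 => ->; rewrite ?normrN normr1.
rewrite /up; case: eqP => // /eqP ii0; apply: yk.
rewrite ltnS leq_eqVlt in ik; case/orP: ik => // /eqP ik.
by case/eqP: ii0; apply: val_inj.
Qed.

(** * Semidefinite matrices and Gram vectors *)

(** This is the form at [x - c e_i]. Choices of [x] and [c] give the bounds on entries below and the
    semidefiniteness of the Schur complement. *)
Lemma psdmx_shift (R : realType) (n : nat) (A : 'M[R]_n) (A_psd : psdmx A)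
    (x : 'cV[R]_n) (i : 'I_n) (c : R) :
  0 <= (x^T *m A *m x) 0 0 - 2 * c * (A *m x) i 0 + c ^+ 2 * A i i.
Proof.
have [AT A0] := A_psd.
have := A0 (x - c *: delta_mx i 0).
have -> : (x - c *: delta_mx i 0)^T = x^T - c *: delta_mx 0 i.
  by rewrite linearB linearZ /= trmx_delta.
rewrite mulmxBr !mulmxBl.
rewrite -!scalemxAl -!scalemxAr.
have -> : x^T *m A *m delta_mx i (0 : 'I_1) = (delta_mx 0 i *m A *m x)^T.
  by rewrite !trmx_mul AT trmx_delta mulmxA.
have rE p (y : 'M[R]_(n, p)) j : (delta_mx (0 : 'I_1) i *m y) 0 j = y i j.
  by rewrite -rowE mxE.
have -> : (A *m x) i 0 = (delta_mx (0 : 'I_1) i *m A *m x) 0 0.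
  by rewrite -mulmxA rE.
have -> : A i i = (delta_mx (0 : 'I_1) i *m A *m delta_mx i (0 : 'I_1)) 0 0.
  by rewrite -mulmxA rE -colE mxE.
set u := x^T *m A *m x; set v := _ *m A *m x; set w := _ *m delta_mx i 0.
by rewrite !mxE; lra.
Qed.

Lemma psdmx_diag_ge0 (R : realType) (n : nat) (A : 'M[R]_n) (i : 'I_n) :
  psdmx A -> 0 <= A i i.
Proof.
by move=> /psdmx_shift/(_ 0 i 1); rewrite !mulmx0 !mxE; lra.
Qed.

Lemma psdmx_entry_le1 (R : realType) (n : nat) (A : 'M[R]_n) (i j : 'I_n) :
  psdmx A -> A i i <= 1 -> A j j <= 1 -> A i j <= 1.
Proof.
move=> A_psd i1 j1; have := psdmx_shift A_psd (delta_mx j 0) i 1.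
by rewrite trmx_delta -rowE -!colE !mxE; lra.
Qed.

Lemma psdmx_diag0 (R : realType) (n : nat) (A : 'M[R]_n) (i j : 'I_n) :
  psdmx A -> A i i = 0 -> A i j = 0.
Proof.
move=> A_psd i0; apply/eqP; rewrite -sqrf_eq0 -[_ == 0]negbK; apply/negP => n0.
have a0 : 0 < A i j ^+ 2 by rewrite lt0r n0 sqr_ge0.
have j0 := psdmx_diag_ge0 j A_psd.
(* This [c] is [(A j j + 1) / A i j], which would give the form the negative value
   [A j j - 2 * (A j j + 1)]. *)
have := psdmx_shift A_psd (delta_mx j 0) i ((A j j + 1) / A i j ^+ 2 * A i j).
rewrite trmx_delta -rowE -!colE !mxE i0 mulr0 addr0.
have -> : 2 * ((A j j + 1) / A i j ^+ 2 * A i j) * A i j = 2 * (A j j + 1).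
  by field; rewrite -sqrf_eq0.
lra.
Qed.

(** Cholesky elimination, by induction on the number of nonzero diagonal entries. The list [ws]
    holds coordinates: the Gram vector of [i] consists of the numbers [w i]. *)
Lemma psdmx_gram (R : realType) (n : nat) (A : 'M[R]_n) : psdmx A ->
  exists ws : seq ('I_n -> R), forall i j, A i j = \sum_(w <- ws) w i * w j.
Proof.
have [m] := ubnP #|[pred i | A i i != 0]|; elim: m A => // m IH A Am A_psd.
have [/existsP[i Ai]|/existsPn A0] := boolP [exists i, A i i != 0]; last first.
  exists [::] => i j; rewrite big_nil psdmx_diag0//.
  by have := A0 i; rewrite negbK => /eqP.
have Ai0 : 0 < A i i by rewrite lt0r Ai psdmx_diag_ge0.
have [AT A0] := A_psd.
have AC p q : A p q = A q p by rewrite -{1}AT mxE.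
pose A' := A - (A i i)^-1 *: (col i A *m row i A).
have A'E p q : A' p q = A p q - A i p * A i q / A i i.
  by rewrite !mxE big_ord1 !mxE (AC p i); ring.
have A'_psd : psdmx A'.
  split; first by apply/matrixP => p q; rewrite mxE !A'E AC; ring.
  (* The minimizing [c] turns the shifted form of [A] into the form of [A']. *)
  move=> x; have := psdmx_shift A_psd x i ((A *m x) i 0 / A i i).
  rewrite /A' mulmxBr mulmxBl -scalemxAr -scalemxAl.
  have -> : x^T *m (col i A *m row i A) *m x =
      (row i (A *m x))^T *m row i (A *m x).
    by rewrite row_mul trmx_mul tr_row AT !mulmxA.
  rewrite !mxE big_ord1 !mxE; set l := \sum_(j < n) A i j * _.
  set q := \sum_(j < n) _.
  suff -> : q - 2 * (l / A i i) * l + (l / A i i) ^+ 2 * A i i =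
    q - (A i i)^-1 * (l * l) by [].
  by field; rewrite gt_eqF.
have A'm : (#|[pred i | A' i i != 0%R]| < m)%N.
  rewrite -ltnS; apply: leq_trans Am; rewrite ltnS; apply: proper_card.
  apply/properP; split.
    apply/subsetP => j; rewrite !inE A'E; apply: contra => /eqP j0.
    by rewrite j0 (AC i j) (psdmx_diag0 i A_psd j0) mul0r mul0r subr0.
  by exists i; rewrite !inE// A'E mulfK// subrr eqxx.
have [ws wsE] := IH A' A'm A'_psd.
exists ((fun j => A i j / Num.sqrt (A i i)) :: ws) => p q.
by rewrite big_cons -wsE A'E mulrACA -invfM -expr2 sqr_sqrtr ?ltW//; ring.
Qed.

(** * Averages of sines over random signs *)

(** The average over all signs [eps] of the quadratic form [M] at
    [i |-> sin (y i + \sum_v eps_v * v i)], by the product-to-sum formula. *)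
Definition sine_average (R : realType) (n : nat) (M : 'M[R]_n)
    (y : 'I_n -> R) (vs : seq ('I_n -> R)) : R :=
  \sum_i \sum_j M i j *
    ((cos (y i - y j) * \prod_(v <- vs) cos (v i - v j) -
      cos (y i + y j) * \prod_(v <- vs) cos (v i + v j)) / 2).

(** Conditioning on the first sign, by [cos (a + b) + cos (a - b) = 2 cos a cos b]. *)
Lemma sine_average_cons (R : realType) (n : nat) (M : 'M[R]_n)
    (y v : 'I_n -> R) (vs : seq ('I_n -> R)) :
  sine_average M y (v :: vs) =
  (sine_average M (fun i => y i + v i) vs +
   sine_average M (fun i => y i - v i) vs) / 2.
Proof.
rewrite /sine_average -big_split mulr_suml; apply: eq_bigr => i _ /=.
rewrite -big_split mulr_suml; apply: eq_bigr => j _ /=; rewrite !big_cons.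
have -> : y i + v i - (y j + v j) = (y i - y j) + (v i - v j) by ring.
have -> : y i - v i - (y j - v j) = (y i - y j) - (v i - v j) by ring.
have -> : y i + v i + (y j + v j) = (y i + y j) + (v i + v j) by ring.
have -> : y i - v i + (y j - v j) = (y i + y j) - (v i + v j) by ring.
move: (y i - y j) (v i - v j) (y i + y j) (v i + v j) => a b c d.
by rewrite (cosD a b) (cosB a b) (cosD c d) (cosB c d); field.
Qed.

(** Method of conditional expectations: each sign in turn is chosen so that the remaining average
    does not grow. *)
Lemma sine_average_realized (R : realType) (n : nat) (M : 'M[R]_n)
    (vs : seq ('I_n -> R)) (y : 'I_n -> R) :
  exists z : 'I_n -> R,
    \sum_i \sum_j M i j * (sin (z i) * sin (z j)) <= sine_average M y vs.
Proof.
elim: vs y => [|v vs IH] y.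
  exists y; rewrite le_eqVlt; apply/orP; left; apply/eqP.
  apply: eq_bigr => i _; apply: eq_bigr => j _.
  by rewrite !big_nil cosB cosD; field.
have [z zP] := IH (fun i => y i + v i).
have [z' zP'] := IH (fun i => y i - v i).
rewrite sine_average_cons.
have [le|lt] := leP (sine_average M (fun i => y i + v i) vs)
                    (sine_average M (fun i => y i - v i) vs).
  by exists z; apply: le_trans zP _; lra.
by exists z'; apply: le_trans zP' _; lra.
Qed.

(** * The Gaussian limit *)

Lemma prod_dist_le_sum (R : realDomainType) (I : Type) (s : seq I)
    (f g : I -> R) : (forall i, `|f i| <= 1) -> (forall i, `|g i| <= 1) ->
  `|\prod_(i <- s) f i - \prod_(i <- s) g i| <= \sum_(i <- s) `|f i - g i|.
Proof.
move=> f1 g1; elim: s => [|i s IH]; first by rewrite !big_nil subrr normr0.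
rewrite !big_cons; set p := \prod_(_ <- _) f _; set q := \prod_(_ <- _) g _.
have -> : f i * p - g i * q = (f i - g i) * p + g i * (p - q) by ring.
apply: le_trans (ler_normD _ _) _; rewrite !normrM; apply: lerD.
  rewrite ler_piMr// /p; elim: s {IH p q} => [|j s IH].
    by rewrite big_nil normr1.
  by rewrite big_cons normrM mulr_ile1.
by apply: le_trans IH; rewrite ler_piMl.
Qed.

Lemma prod_cos_expR_dist (R : realType) (I : Type) (s : seq I) (f : I -> R) :
  `|\prod_(i <- s) cos (f i) - expR (- (\sum_(i <- s) f i ^+ 2 / 2))| <=
  \sum_(i <- s) f i ^+ 4 / 4.
Proof.
rewrite -sumrN expR_sum.
apply: le_trans (prod_dist_le_sum _ _ _) _ => [i|i|].
- exact: cos_max.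
- rewrite ger0_norm ?expR_ge0// expR_le1 oppr_le0.
  by rewrite mulr_ge0 ?sqr_ge0// invr_ge0.
- by apply: ler_sum => i _; exact: cos_expR_dist.
Qed.

(** The signed sums of [N ^ 2] copies of [w / N] are approximately Gaussian,
    with the variance of [w]. *)
Definition subdivide (R : realType) (T : Type) (N : nat)
    (ws : seq (T -> R)) : seq (T -> R) :=
  flatten (nseq (N ^ 2) [seq (fun t => w t / N%:R) | w <- ws]).

Lemma sum_subdivide (R : realType) (T : Type) (N : nat) (ws : seq (T -> R))
    (F : (T -> R) -> R) :
  \sum_(v <- subdivide N ws) F v =
  N%:R ^+ 2 * \sum_(w <- ws) F (fun t => w t / N%:R).
Proof.
rewrite /subdivide big_flatten big_nseq /= big_map iter_addr addr0.
by rewrite -natrX mulr_natl.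
Qed.

(** Subdividing keeps the sum of squares and divides that of fourth powers by [N ^ 2]; the weaker
    rate [1 / N] suffices. The functionals [L] of interest are [w i - w j] and [w i + w j]. *)
Lemma prod_cos_subdivide (R : realType) (T : Type) (N : nat)
    (ws : seq (T -> R)) (L : (T -> R) -> R)
    (LZ : forall w, L (fun t => w t / N%:R) = L w / N%:R) : (0 < N)%N ->
  `|\prod_(v <- subdivide N ws) cos (L v) -
    expR (- (\sum_(w <- ws) L w ^+ 2 / 2))| <=
  (\sum_(w <- ws) L w ^+ 4) / N%:R.
Proof.
move=> N0; have N0' : 0 < N%:R :> R by rewrite ltr0n.
have N1 : 1 <= N%:R :> R by rewrite ler1n.
have := prod_cos_expR_dist (subdivide N ws) L; rewrite !sum_subdivide.
have -> : N%:R ^+ 2 * (\sum_(w <- ws) L (fun t => w t / N%:R) ^+ 2 / 2) =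
    \sum_(w <- ws) L w ^+ 2 / 2.
  rewrite mulr_sumr; apply: eq_bigr => w _; rewrite LZ.
  by field; rewrite gt_eqF.
move=> /le_trans; apply; rewrite mulr_sumr mulr_suml; apply: ler_sum => w _.
rewrite LZ.
have -> : N%:R ^+ 2 * ((L w / N%:R) ^+ 4 / 4) = (L w ^+ 4 / N%:R) / (4 * N%:R).
  by field; rewrite gt_eqF.
rewrite ler_pdivrMr; last by lra.
rewrite ler_peMr ?divr_ge0 ?exprn_even_ge0 ?ltW//; lra.
Qed.

Lemma gram_expand (R : realType) (n : nat) (A : 'M[R]_n)
    (ws : seq ('I_n -> R)) (AE : forall i j, A i j = \sum_(w <- ws) w i * w j)
    (A1 : forall i, A i i = 1) (i j : 'I_n) :
  \sum_(w <- ws) (w i - w j) ^+ 2 / 2 = 1 - A i j /\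
  \sum_(w <- ws) (w i + w j) ^+ 2 / 2 = 1 + A i j.
Proof.
split.
  have -> : 1 - A i j = (A i i + A j j) / 2 - A i j by rewrite !A1; field.
  rewrite !AE -big_split mulr_suml /= -sumrB.
  by apply: eq_bigr => w _ /=; field.
have -> : 1 + A i j = (A i i + A j j) / 2 + A i j by rewrite !A1; field.
rewrite !AE -big_split mulr_suml /= -big_split.
by apply: eq_bigr => w _ /=; field.
Qed.

Lemma sine_average_limit (R : realType) (n : nat) (M A : 'M[R]_n)
    (A_psd : psdmx A) (A1 : forall i, A i i = 1) (e : R) : 0 < e ->
  exists vs, sine_average M (fun=> 0) vs <=
    \sum_i \sum_j M i j * scaled_sinh (A i j) + e.
Proof.
have [ws AE] := psdmx_gram A_psd => e0.
(* [C / N] bounds the total error of [prod_cos_subdivide] over all entries. *)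
pose C := \sum_i \sum_j `|M i j| * (\sum_(w <- ws) (w i - w j) ^+ 4 +
   \sum_(w <- ws) (w i + w j) ^+ 4).
pose N := (Num.truncn (C / e)).+1.
have CN : C / N%:R <= e.
  rewrite ler_pdivrMr ?ltr0n// mulrC -ler_pdivrMr// ltW//.
  by rewrite truncnS_gt.
exists (subdivide N ws); rewrite -lerBlDl; apply: le_trans CN.
rewrite /C mulr_suml -sumrB; apply: ler_sum => i _.
rewrite mulr_suml -sumrB; apply: ler_sum => j _.
rewrite -mulrBr -mulrA; apply: le_trans (ler_norm _) _.
rewrite normrM ler_wpM2l// subrr addr0 cos0 !mul1r /scaled_sinh.
have [em ep] := gram_expand AE A1 i j.
have := @prod_cos_subdivide _ _ N ws (fun w => w i - w j)
  (fun w => esym (mulrBl _ _ _)) isT.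
have := @prod_cos_subdivide _ _ N ws (fun w => w i + w j)
  (fun w => esym (mulrDl _ _ _)) isT.
rewrite em ep opprB opprD.
have -> : -1 - A i j = - A i j - 1 by ring.
rewrite !ler_norml => /andP[? ?] /andP[? ?].
by apply/andP; split; lra.
Qed.

(** That [scaled_sinh (A i j)] is off the diagonal an average of sign products is expressed through
    linear functionals [M], so that no probability measure is needed. *)
Lemma sign_vector_below_sinh (R : realType) (n : nat) (M A : 'M[R]_n)
    (A_psd : psdmx A) (A1 : forall i, A i i = 1) (M0 : forall i, M i i = 0) :
  exists s : {ffun 'I_n -> bool},
    \sum_i \sum_j M i j * ((-1) ^+ s i * (-1) ^+ s j) <=
    \sum_i \sum_j M i j * scaled_sinh (A i j).
Proof.
pose F (s : {ffun 'I_n -> bool}) :=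
  \sum_i \sum_j M i j * ((-1) ^+ s i * (-1) ^+ s j).
(* A minimizer among the finitely many sign vectors serves every [e] at once, so [e] can tend to
   0. *)
have [s _ sF] := arg_minP F (erefl true : predT [ffun=> false]).
exists s; apply/ler_addgt0Pr => e e0.
have [vs vsP] := sine_average_limit M A_psd A1 e0.
have [z zP] := sine_average_realized M vs (fun=> 0).
have [t tP] := quadratic_rounding M0 (fun i => sin_max (z i)).
exact: le_trans (sF t isT) (le_trans tP (le_trans zP vsP)).
Qed.

(** * Maurey's sparsification *)

(** As [X ^ 2 = 1], the squared error after adding one more vector is affine in
    that vector, so some vector does at least as well as their average [K],
    which increases the error by the sum of [1 - K ^ 2]. *)
Lemma sparse_average (R : realType) (I : finType) (S : eqType) (P : pred I)
    (X : S -> I -> R) (K : I -> R) (X1 : forall s i, X s i ^+ 2 = 1)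
    (XK : forall W : I -> R, exists s,
       \sum_(i | P i) W i * X s i <= \sum_(i | P i) W i * K i) (r : nat) :
  exists ss : r.-tuple S,
    \sum_(i | P i) (\sum_(k < r) X (tnth ss k) i - r%:R * K i) ^+ 2 <=
    r%:R * #|P|%:R.
Proof.
elim: r => [|r [ss IH]].
  exists [tuple]; rewrite mul0r big1// => i _.
  by rewrite big_ord0 mul0r subr0 expr0n.
pose D i := \sum_(k < r) X (tnth ss k) i - r%:R * K i.
have [s sP] := XK (fun i => D i - K i).
exists [tuple of s :: ss].
have E i : \sum_(k < r.+1) X (tnth [tuple of s :: ss] k) i - r.+1%:R * K i =
    D i - K i + X s i.
  rewrite big_ord_recl tnth0 /D -(natr1 r).
  under eq_bigr do rewrite tnthS.
  by ring.
under eq_bigr do rewrite E.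
have E2 i : (D i - K i + X s i) ^+ 2 =
    D i ^+ 2 + 1 + 2 * ((D i - K i) * X s i) - 2 * ((D i - K i) * K i) -
    K i ^+ 2.
  by rewrite sqrrD X1; ring.
under eq_bigr do rewrite E2.
rewrite !sumrB !big_split -!mulr_sumr /= sumr_const -(natr1 r).
have : 0 <= \sum_(i | P i) K i ^+ 2 by apply: sumr_ge0 => i _; exact: sqr_ge0.
move: IH; rewrite -/D mulrDl mul1r; lra.
Qed.

(** * Block averages as least-squares approximations *)

Lemma mean_least_squares (R : realType) (I : finType) (Q : pred I)
    (a : I -> R) (t : R) :
  \sum_(i | Q i) (a i - (\sum_(j | Q j) a j) / #|Q|%:R) ^+ 2 <=
  \sum_(i | Q i) (a i - t) ^+ 2.
Proof.
set k := #|Q|%:R; set m := _ / k.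
have km : \sum_(j | Q j) a j = k * m.
  (* For empty [Q] both sides are 0, whatever value [m] gets from dividing by 0. *)
  rewrite /m /k; have [Q0|Q0] := eqVneq #|Q| 0%N; last first.
    by field; rewrite pnatr_eq0.
  by rewrite Q0 mul0r big_pred0// => i; exact: card0_eq Q0 i.
rewrite -subr_ge0 -sumrB.
have -> : \sum_(i | Q i) ((a i - t) ^+ 2 - (a i - m) ^+ 2) =
    \sum_(i | Q i) (2 * (m - t) * a i + (t ^+ 2 - m ^+ 2)).
  by apply: eq_bigr => i _; ring.
rewrite big_split -mulr_sumr /= sumr_const -/k km -[(_ - _) *+ _]mulr_natl -/k.
rewrite [leRHS](_ : _ = k * (m - t) ^+ 2); last by ring.
by rewrite mulr_ge0 ?sqr_ge0// ler0n.
Qed.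

Lemma fiber_mean_least_squares (R : realType) (I T : finType) (F : I -> T)
    (a : I -> R) (h : T -> R) :
  \sum_i (a i - (\sum_(j | F j == F i) a j) / #|[pred j | F j == F i]|%:R) ^+ 2
  <= \sum_i (a i - h (F i)) ^+ 2.
Proof.
rewrite (partition_big F predT)//= [leRHS](partition_big F predT)//=.
apply: ler_sum => c _.
under eq_bigr => i /eqP -> do [].
under [leRHS]eq_bigr => i /eqP -> do [].
exact: mean_least_squares.
Qed.

(** The blocks are the fibers of [(i, j) |-> (f i, f j)]. Any [h (f i) (f j)] is constant on them,
    so block means do at least as well, for all [h] at once. *)
Lemma partition_average (R : realType) (n : nat) (A : 'M[R]_n) (T : finType)
    (f : 'I_n -> T) :
  exists (P : {set {set 'I_n}}) (B : 'M[R]_n),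
    [/\ partition P [set: 'I_n], (#|P| <= #|T|)%N, block_constant P B,
        block_average P A B &
        forall h : T -> T -> R,
          \sum_i \sum_j (A i j - B i j) ^+ 2 <=
          \sum_i \sum_j (A i j - h (f i) (f j)) ^+ 2].
Proof.
pose blk p := [set s | f s == f p].
pose avg (I J : {set 'I_n}) : R :=
  (#|I|%:R * #|J|%:R)^-1 * \sum_(s in I) \sum_(t in J) A s t.
pose B : 'M[R]_n := \matrix_(p, q) avg (blk p) (blk q).
have blkE I p : I \in preim_partition f [set: 'I_n] -> p \in I -> I = blk p.
  case/imsetP => x _ ->; rewrite !inE /= => /eqP xp.
  by apply/setP => y; rewrite !inE xp eq_sym.
have avgB : block_average (preim_partition f [set: 'I_n]) A B.
  by move=> I J IP JP p q pI qJ; rewrite (blkE I p)// (blkE J q)// mxE.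
exists (preim_partition f [set: 'I_n]), B; split=> //.
- exact: preim_partitionP.
- apply: (@leq_trans #|[set [set y | c == f y] | c in T]|); last first.
    exact: leq_imset_card.
  apply/subset_leq_card/subsetP => I /imsetP[x _ ->].
  by apply/imsetP; exists (f x) => //; apply/setP => y; rewrite !inE.
- move=> I J IP JP; exists (avg I J) => p q pI qJ.
  exact: avgB.
move=> h; rewrite !pair_bigA /=.
have := fiber_mean_least_squares (fun z : 'I_n * 'I_n => (f z.1, f z.2))
  (fun z => A z.1 z.2) (fun c => h c.1 c.2).
move=> /=; apply: le_trans; rewrite le_eqVlt; apply/orP; left; apply/eqP.
apply: eq_bigr => z _; congr ((_ - _) ^+ 2).
rewrite mxE /avg mulrC pair_big /=; congr (_ / _).
  by apply: eq_bigl => -[s t]; rewrite !inE.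
rewrite -natrM -cardsX; congr (_%:R); apply: eq_card => -[s t].
by rewrite !inE.
Qed.

(** * Approximation by labels, and the theorem *)

Lemma psdmx_unit_diag (R : realType) (n : nat) (A : 'M[R]_n)
    (A_psd : psdmx A) (A_diag : forall i, A i i <= 1) :
  exists A' : 'M[R]_n, [/\ psdmx A', forall i, A' i i = 1 &
    forall i j, i != j -> A' i j = A i j].
Proof.
exists (A + diag_mx (\row_i (1 - A i i))); have [AT A0] := A_psd; split.
- split; first by rewrite linearD /= AT tr_diag_mx.
  move=> x; rewrite mulmxDr mulmxDl mxE addr_ge0//.
  rewrite mxE sumr_ge0// => i _.
  rewrite mul_mx_diag !mxE mulrAC mulr_ge0 ?subr_ge0//.
  by rewrite -expr2 sqr_ge0.
- by move=> i; rewrite !mxE eqxx mulr1n addrC subrK.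
- by move=> i j ij; rewrite !mxE (negPf ij) mulr0n addr0.
Qed.

Lemma psdmx_label_approx (R : realType) (n : nat) (A : 'M[R]_n)
    (A_psd : psdmx A) (A_diag : forall i, A i i <= 1)
    (r : nat) (r_gt0 : (0 < r)%N) :
  exists (f : 'I_n -> {ffun 'I_r -> bool})
         (h : {ffun 'I_r -> bool} -> {ffun 'I_r -> bool} -> R),
    \sum_i \sum_j (A i j - h (f i) (f j)) ^+ 2 <=
    expR 1 ^+ 2 * n%:R ^+ 2 / r%:R + n%:R.
Proof.
have r0 : 0 < r%:R :> R by rewrite ltr0n.
have [A' [A'_psd A'1 A'E]] := psdmx_unit_diag A_psd A_diag.
pose P := [pred z : 'I_n * 'I_n | z.1 != z.2].
pose X (s : {ffun 'I_n -> bool}) (z : 'I_n * 'I_n) : R :=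
  (-1) ^+ s z.1 * (-1) ^+ s z.2.
pose K (z : 'I_n * 'I_n) := scaled_sinh (A z.1 z.2).
have X1 s z : X s z ^+ 2 = 1 by rewrite exprMn !sqrr_sign mulr1.
have XK (W : 'I_n * 'I_n -> R) : exists s,
    \sum_(z | P z) W z * X s z <= \sum_(z | P z) W z * K z.
  (* Clearing the diagonal of [W] permits sign rounding and makes [A] and [A'] interchangeable. *)
  pose M := \matrix_(i, j) if i != j then W (i, j) else 0.
  have M0 i : M i i = 0 by rewrite mxE eqxx.
  have [s] := sign_vector_below_sinh A'_psd A'1 M0.
  rewrite !pair_bigA /= => sP; exists s.
  rewrite !(big_mkcond P) /=; move: sP; congr (is_true (_ <= _));
    apply: eq_bigr => -[i j] _; rewrite mxE /=; case: eqP => [_|/eqP ij];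
    by rewrite ?mul0r// /K A'E.
have [ss ssP] := sparse_average X1 XK r.
have [h [h1 hP]] := scaled_sinh_inverse R.
(* The label of [i] is its sign pattern in the [r] vectors; [h] is applied to the mean product of
   two patterns. *)
exists (fun i => [ffun k => tnth ss k i]),
  (fun c d : {ffun 'I_r -> bool} =>
    h (r%:R^-1 * \sum_k (-1) ^+ c k * (-1) ^+ d k)).
have SE i j : \sum_k (-1) ^+ [ffun k => tnth ss k i] k *
    (-1) ^+ [ffun k => tnth ss k j] k = \sum_(k < r) X (tnth ss k) (i, j).
  by apply: eq_bigr => k _; rewrite !ffunE.
under eq_bigr do under eq_bigr do rewrite SE.
rewrite pair_bigA (bigID P) /=; apply: lerD.
  apply: (@le_trans _ _ ((expR 1 / r%:R) ^+ 2 * (r%:R * #|P|%:R))).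
    rewrite -ler_pdivrMl; last by rewrite exprn_gt0// divr_gt0 ?expR_gt0.
    apply: le_trans ssP; rewrite mulr_sumr; apply: ler_sum => -[i j] _ /=.
    rewrite ler_pdivrMl; last by rewrite exprn_gt0// divr_gt0 ?expR_gt0.
    set t := r%:R^-1 * _.
    have := hP (A i j) t (psdmx_entry_le1 A_psd (A_diag i) (A_diag j)).
    rewrite -(ler_pXn2r (n := 2)) ?nnegrE ?mulr_ge0 ?expR_ge0//.
    rewrite exprMn !real_normK ?num_real// -[(h t - _) ^+ 2]sqrrN opprB.
    move=> /le_trans; apply; rewrite le_eqVlt; apply/orP; left; apply/eqP.
    by rewrite /t /K /=; field; rewrite gt_eqF.
  have Pn : #|P|%:R <= n%:R ^+ 2 :> R.
    by rewrite -natrX ler_nat (leq_trans (max_card _))// card_prod card_ord.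
  have -> : (expR 1 / r%:R) ^+ 2 * (r%:R * #|P|%:R) =
    expR 1 ^+ 2 / r%:R * #|P|%:R :> R by field; rewrite gt_eqF.
  rewrite [leRHS]mulrAC ler_wpM2l// divr_ge0 ?sqr_ge0// ltW//.
(* On the diagonal [h] is evaluated at 1, and each term [(A i i - 1) ^+ 2] is at most 1. *)
rewrite (reindex (fun i : 'I_n => (i, i))) /=; last first.
  exists fst => [i _|[i j]] //=; by rewrite inE negbK /= => /eqP ->.
rewrite (eq_bigl predT) => [|i]; last by rewrite eqxx.
have -> : n%:R = \sum_(i < n) 1 :> R by rewrite sumr_const card_ord.
apply: ler_sum => i _; have -> : \sum_(k < r) X (tnth ss k) (i, i) = r%:R.
  rewrite (eq_bigr (fun=> 1)) ?sumr_const ?card_ord// => k _.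
  by rewrite /X /= -expr2 sqrr_sign.
rewrite mulVf ?gt_eqF// h1; have := psdmx_diag_ge0 i A_psd.
by have := A_diag i => a1 a0; nra.
Qed.

Theorem theorem5p3 (R : realType) (n : nat) (n_gt0 : (0 < n)%N)
    (A : 'M[R]_n) (A_psd : psdmx A) (A_diag : forall i, A i i <= 1)
    (r : nat) (r_gt0 : (0 < r)%N) :
  exists (P : {set {set 'I_n}}) (B : 'M[R]_n),
    [/\ partition P [set: 'I_n],
        (#|P| <= 2 ^ r)%N,
        block_constant P B,
        n%:R^-1 * frobenius (A - B) <= pi / Num.sqrt r%:R
      & block_average P A B].
Proof.
have r0 : 0 < r%:R :> R by rewrite ltr0n.
have n0 : 0 < n%:R :> R by rewrite ltr0n.
suff [T [f [h [cT hP]]]] :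
    exists (T : finType) (f : 'I_n -> T) (h : T -> T -> R),
    (#|T| <= 2 ^ r)%N /\ \sum_i \sum_j (A i j - h (f i) (f j)) ^+ 2 <=
      (pi * n%:R / Num.sqrt r%:R) ^+ 2.
  have [P [B [Ppart cP Bc Ba Bmin]]] := partition_average A f.
  exists P, B; split=> //; first exact: leq_trans cT.
  rewrite ler_pdivrMl// mulrA [n%:R * pi]mulrC /frobenius.
  have sr : 0 < Num.sqrt r%:R :> R by rewrite sqrtr_gt0.
  have t0 : 0 <= pi * n%:R / Num.sqrt r%:R :> R.
    by rewrite divr_ge0 ?mulr_ge0 ?pi_ge0 ?ltW.
  rewrite -[leRHS](ger0_norm t0) -sqrtr_sqr ler_wsqrtr//.
  apply: le_trans hP; apply: le_trans (Bmin h).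
  by under eq_bigr do under eq_bigr do rewrite !mxE.
have [rn|rn] := leqP n (2 ^ r).
  exists 'I_n, id, A; rewrite card_ord; split=> //.
  rewrite !big1 ?sqr_ge0// => i _; rewrite big1// => j _.
  by rewrite subrr expr0n.
have [f [h hP]] := psdmx_label_approx A_psd A_diag r_gt0.
exists {ffun 'I_r -> bool}, f, h.
rewrite card_ffun card_bool card_ord; split=> //; apply: le_trans hP _.
(* Since [r < 2 ^ r < n], the diagonal error [n] is at most [n ^ 2 / r]. *)
have rn' : r%:R <= n%:R :> R.
  by rewrite ler_nat ltnW// (ltn_trans _ rn)// ltn_expl.
rewrite expr_div_n (sqr_sqrtr (ltW r0)) exprMn.
rewrite -(ler_pM2r r0) mulrDl !divfK ?gt_eqF//.
have e8 := expR1_sqr_le8 R; have p3 := pi_ge3 R.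
have p9 : 9 <= pi ^+ 2 :> R by nra.
have n2 : 0 <= n%:R ^+ 2 :> R by rewrite sqr_ge0.
have nr : n%:R * r%:R <= n%:R ^+ 2 :> R.
  by rewrite expr2; apply: ler_wpM2l rn'; exact: ltW.
have := ler_wpM2r n2 e8; have := ler_wpM2r n2 p9; lra.
Qed.
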